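(* Let $-1\le\alpha<\beta\le 1$ with $\beta^2\ge\alpha^2$, and let $B_{\alpha\beta}=\{x\in\mathbb{R}^n:\|x\|\le 1,\ \alpha\le x_1\le\beta\}$. The maximum volume inscribed ellipsoid $\mathrm{IE}(B_{\alpha\beta})$ has the form $E=c+A(B_n)$ where $c=\tau e_1$, $\alpha<\tau<\beta$, $A=\mathrm{diag}(a,b,\ldots,b)$ with $a>0$, $b>0$, satisfying the following conditions: (i) If $\alpha=-\beta$, then $\tau=0$, $a=\beta$, $b=1$. (ii) If $4n(1-\alpha^2)<(n+1)^2(\beta^2-\alpha^2)$, then $$\tau=\frac{\alpha+\sqrt{\alpha^2+4n(1-\alpha^2)/(n+1)^2}}{2},\qquad a=\tau-\alpha,\qquad b^2=a(a+n\tau).$$ (iii) If $4n(1-\alpha^2)\ge(n+1)^2(\beta^2-\alpha^2)$ and $\alpha\ne-\beta$, then $$\tau=\frac{\beta+\alpha}{2},\qquad a=\frac{\beta-\alpha}{2},\qquad b^2=a^2+\left(\frac{\beta^2-\alpha^2}{2\left(\sqrt{1-\alpha^2}-\sqrt{1-\beta^2}\right)}\right)^2.$$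
   Context: $B_n=\{u\in\mathbb{R}^n:\|u\|\le1\}$ is the closed Euclidean unit ball and $e_1=(1,0,\ldots,0)^T$. A convex body is a compact convex set with nonempty interior. For a convex body $K\subset\mathbb{R}^n$, $\mathrm{IE}(K)$ denotes the unique ellipsoid of maximum volume contained in $K$; ellipsoids are sets $c+A(B_n)=\{c+Au:u\in B_n\}$ with $A$ symmetric positive definite and $c\in\mathbb{R}^n$. *)

(* Defs.v *)
From mathcomp Require Import all_boot all_order all_algebra.
From mathcomp Require Import all_classical all_reals all_analysis.

Set Implicit Arguments.
Unset Strict Implicit.
Unset Printing Implicit Defensive.

Import Order.TTheory GRing.Theory Num.Theory.
Import numFieldNormedType.Exports.

Local Open Scope classical_set_scope.
Local Open Scope ring_scope.

(* The norm `|x| that MathComp-Analysis puts on matrices is the sup norm. *)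
Definition enorm (R : realType) (n : nat) (x : 'cV[R]_n) : R :=
  Num.sqrt (\sum_(i < n) x i 0 ^+ 2).

Definition unit_ball (R : realType) (n : nat) : set 'cV[R]_n :=
  [set u | enorm u <= 1].

Definition e1 (R : realType) (n : nat) (n_gt0 : (0 < n)%N) : 'cV[R]_n :=
  delta_mx (Ordinal n_gt0) 0.

Definition box (R : realType) (n : nat) (l u : 'cV[R]_n) : set 'cV[R]_n :=
  [set x | forall i, l i 0 <= x i 0 <= u i 0].

(* n-dimensional Lebesgue outer measure: the infimum of the total volume of
   countable covers by closed boxes.  It is the Lebesgue measure on every
   measurable set, in particular on convex bodies and ellipsoids. *)
Definition volume (R : realType) (n : nat) (S : set 'cV[R]_n) : \bar R :=
  ereal_inf [set v | exists l u : nat -> 'cV[R]_n,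
    [/\ (forall k i, l k i 0 <= u k i 0),
        S `<=` \bigcup_k box (l k) (u k) &
        v = (\sum_(0 <= k <oo) (\prod_(i < n) (u k i 0 - l k i 0))%:E)%E]].

Definition sym_posdef (R : realType) (n : nat) (A : 'M[R]_n) : Prop :=
  A^T = A /\ forall x : 'cV[R]_n, x != 0 -> 0 < (x^T *m A *m x) 0 0.

Definition ellipsoid (R : realType) (n : nat) (c : 'cV[R]_n) (A : 'M[R]_n) :
    set 'cV[R]_n :=
  [set c + A *m u | u in @unit_ball R n].

Definition is_ellipsoid (R : realType) (n : nat) (E : set 'cV[R]_n) : Prop :=
  exists c A, sym_posdef A /\ E = ellipsoid c A.

Definition max_volume_ellipsoid (R : realType) (n : nat)
    (K E : set 'cV[R]_n) : Prop :=
  [/\ is_ellipsoid E, E `<=` K &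
      forall E', is_ellipsoid E' -> E' `<=` K -> (volume E' <= volume E)%E].

(* [is_IE K E] is E = IE(K), uniqueness of the maximiser included. *)
Definition is_IE (R : realType) (n : nat) (K E : set 'cV[R]_n) : Prop :=
  max_volume_ellipsoid K E /\
  forall E', max_volume_ellipsoid K E' -> E' = E.

Definition ball_slab (R : realType) (n : nat) (n_gt0 : (0 < n)%N)
    (alpha beta : R) : set 'cV[R]_n :=
  [set x | enorm x <= 1 /\ alpha <= x (Ordinal n_gt0) 0 <= beta].

(* diag(a, b, ..., b) *)
Definition diag_ab (R : realType) (n : nat) (n_gt0 : (0 < n)%N) (a b : R) :
    'M[R]_n :=
  diag_mx (\row_(i < n) if i == Ordinal n_gt0 then a else b).

(* Main.v *)
(* An inscribed ellipsoid c + A B with A = L D L^T (L unit lower triangular) has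
   volume (prod d_i) vol B, because shears do not increase volume, and d_i is at
   most the diagonal entry A_ii.  For the claimed optimum diag(a, b, ..., b) it
   is therefore enough to show A_11/a + sum_(i > 1) A_ii/b <= n, by AM-GM.  This
   is linear in A and c: it is a nonnegative combination of the conditions that
   c + A B lies below the supporting hyperplanes of the slab at the contact
   points of the optimum, namely its poles on the planes x_1 = alpha, beta and
   the latitude circle where it touches the sphere.  Sign symmetry of that circle
   cancels the off-diagonal entries.  Equality in AM-GM and in d_i <= A_ii forces
   A = diag(a, b, ..., b), and then the same conditions determine c. *)
Require Import Defs.
From mathcomp Require Import all_boot all_order all_algebra.
From mathcomp Require Import all_classical all_reals all_analysis.

From mathcomp Require Import measurable_realfun.
From mathcomp Require Import ring lra.

Set Implicit Arguments.
Unset Strict Implicit.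
Unset Printing Implicit Defensive.

Import Order.TTheory GRing.Theory Num.Theory.
Import numFieldNormedType.Exports.

Local Open Scope classical_set_scope.
Local Open Scope ring_scope.

(** * Volume under linear maps *)

Lemma side_prod_ge0 (R : realType) (n : nat) (l u : 'cV[R]_n) :
  (forall i, l i 0 <= u i 0) -> (0 <= (\prod_(i < n) (u i 0 - l i 0))%:E)%E.
Proof.
by move=> lu; rewrite lee_fin; apply: prodr_ge0 => i _; rewrite subr_ge0.
Qed.

Lemma volume_ge0 (R : realType) (n : nat) (S : set 'cV[R]_n) :
  (0 <= volume S)%E.
Proof.
apply/le_ereal_inf_tmp => _ [l [u [lu _ ->]]].
by apply: nneseries_ge0 => k _ _; exact: side_prod_ge0.
Qed.

Lemma le_volume (R : realType) (n : nat) (S T : set 'cV[R]_n) :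
  S `<=` T -> (volume S <= volume T)%E.
Proof.
move=> ST; apply/le_ereal_inf_tmp => _ [l [u [lu Tlu ->]]].
apply: ereal_inf_lbound; exists l, u; split=> //.
exact: subset_trans Tlu.
Qed.

(** Countable subadditivity. If every [S k] has finite volume, choose for each a cover within
    [e / 2 ^ k.+1] of the infimum; a bijection between [nat] and [nat * nat] lists all these boxes
    as one cover of the union. *)
Lemma volume_bigcup_le (R : realType) (n : nat) (S : nat -> set 'cV[R]_n) :
  (volume (\bigcup_k S k) <= \sum_(0 <= k <oo) volume (S k))%E.
Proof.
have [[i ioo]|] := pselect (exists i, volume (S i) = +oo%E).
  rewrite (eseries_pinfty _ _ ioo) ?leey// => k _.
  by rewrite -ltNye (lt_le_trans _ (volume_ge0 _)).
rewrite -forallNE => Soo.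
apply/lee_addgt0Pr => e e0.
rewrite (le_trans _ (epsilon_trick _ _ _))//; last 2 first.
- by move=> k; exact: volume_ge0.
- exact: ltW.
pose P k (b : nat -> 'cV[R]_n * 'cV[R]_n) :=
  [/\ (forall m i, (b m).1 i 0 <= (b m).2 i 0),
      S k `<=` \bigcup_m box (b m).1 (b m).2 &
      (\sum_(0 <= m <oo) (\prod_(i < n) ((b m).2 i 0 - (b m).1 i 0))%:E
       <= volume (S k) + (e / (2 ^ k.+1)%:R)%:E)%E].
have [G PG] : {G : nat -> nat -> 'cV[R]_n * 'cV[R]_n & forall k, P k (G k)}.
  apply: (@choice _ _ P) => k.
  have ek : 0 < e / (2 ^ k.+1)%:R by rewrite divr_gt0// ltr0n expn_gt0.
  have Sfin : volume (S k) \is a fin_num.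
    by rewrite ge0_fin_numE ?volume_ge0// ltey; apply/eqP/Soo.
  have [x [l [u [lu Slu ->]]] xS] := lb_ereal_inf_adherent ek Sfin.
  by exists (fun m => (l m, u m)); split => //; exact: ltW.
pose F (p : nat * nat) : \bar R :=
  (\prod_(i < n) ((G p.1 p.2).2 i 0 - (G p.1 p.2).1 i 0))%:E.
have F0 p : (0 <= F p)%E by case: (PG p.1) => lu _ _; exact: side_prod_ge0.
apply: (@le_trans _ _ (\esum_(p in setT) F p)%E); last first.
  rewrite (_ : esum _ _ = \sum_(0 <= k <oo) \sum_(0 <= m <oo) F (k, m))%E.
    apply: lee_nneseries => [k _ _|k _]; first by apply: nneseries_ge0.
    by case: (PG k).
  rewrite nneseries_esumT; last by move=> k; exact: nneseries_ge0.
  transitivity (\esum_(k in [set: nat]) \esum_(m in [set: nat]) F (k, m))%E.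
    rewrite (esum_esum (a := fun k m => F (k, m)))//.
    have -> : [set: nat * nat] = [set: nat] `*`` (fun=> [set: nat]).
      by apply/seteqP; split.
    by apply: eq_esum => -[].
  by apply: eq_esum => k _; rewrite nneseries_esumT.
have /card_esym/ppcard_eqP[f] := card_nat2.
apply: ereal_inf_lbound => /=.
exists (fun k => (G (f k).1 (f k).2).1), (fun k => (G (f k).1 (f k).2).2); split.
- by move=> k i; case: (PG (f k).1).
- move=> t [i _ Sit]; have [_ /(_ t Sit)[j _ Gt] _] := PG i.
  by exists (f^-1%FUN (i, j)) => //=; rewrite invK ?inE.
- rewrite nneseries_esumT; last by move=> k; exact: (F0 (f k)).
  rewrite (reindex_esum [set: nat] [set: nat * nat] f)//.
Qed.

Lemma volume_box_le (R : realType) (n : nat) (n_gt0 : (0 < n)%N)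
    (l u : 'cV[R]_n) : (forall i, l i 0 <= u i 0) ->
  (volume (box l u) <= (\prod_(i < n) (u i 0 - l i 0))%:E)%E.
Proof.
move=> lu; apply: ereal_inf_lbound.
(* Covers are infinite sequences, so the tail is filled with the degenerate box from [l] to [l],
   whose side product is 0 because [0 < n]. *)
exists (fun=> l), (fun k => if k == 0%N then u else l); split.
- by move=> [|k] i /=.
- by move=> x xlu; exists 0%N.
rewrite nneseries_recl//=; last first.
  by move=> [|k] _; exact: side_prod_ge0.
rewrite eseries0 ?adde0// => -[//|k] _ _ /=.
by rewrite (bigD1 (Ordinal n_gt0))//= subrr mul0r.
Qed.

Lemma volume_bigcup_box_le (R : realType) (n N : nat) (n_gt0 : (0 < n)%N)
    (l u : nat -> 'cV[R]_n) : (forall k i, l k i 0 <= u k i 0) ->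
  (volume (\bigcup_(k in `I_N) box (l k) (u k))
   <= (\sum_(k < N) \prod_(i < n) (u k i 0 - l k i 0))%:E)%E.
Proof.
move=> lu; apply: ereal_inf_lbound.
exists l, (fun k => if (k < N)%N then u k else l k); split.
- by move=> k i; case: ifP.
- by move=> x [k /= kN xk]; exists k => //=; rewrite kN.
rewrite (nneseries_split 0 N); last first.
  by move=> k _; apply: side_prod_ge0 => i; case: ifP.
rewrite add0n eseries0 ?adde0; last first.
  move=> k kN _; rewrite ltnNge kN/= (bigD1 (Ordinal n_gt0))//=.
  by rewrite subrr mul0r.
rewrite big_mkord -sumEFin; apply: eq_bigr => k _.
by rewrite ltn_ord.
Qed.

(** A bound on boxes suffices: the images of the boxes of a cover of [S] cover the image of [S], and
    subadditivity sums their volumes. *)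
Lemma volume_image_le (R : realType) (n : nat) (f : 'cV[R]_n -> 'cV[R]_n)
    (d : R) : 0 < d ->
  (forall l u : 'cV[R]_n, (forall i, l i 0 <= u i 0) ->
    (volume (f @` box l u) <= (d * \prod_(i < n) (u i 0 - l i 0))%:E)%E) ->
  forall S, (volume (f @` S) <= d%:E * volume S)%E.
Proof.
move=> d0 fbox S; rewrite -lee_pdivrMl//.
apply/le_ereal_inf_tmp => _ [l [u [lu Slu ->]]]; rewrite lee_pdivrMl//.
apply: (@le_trans _ _ (volume (\bigcup_k f @` box (l k) (u k)))).
  apply: le_volume => _ [x Sx <-].
  by have [k _ xk] := Slu _ Sx; exists k => //; exists x.
apply: (le_trans (volume_bigcup_le _)).
rewrite -nneseriesZl; last by move=> k _; exact: side_prod_ge0.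
apply: lee_nneseries => [k _ _|k _]; first exact: volume_ge0.
by rewrite -EFinM; exact: fbox.
Qed.

Lemma volume_translate_le (R : realType) (n : nat) (n_gt0 : (0 < n)%N)
    (c : 'cV[R]_n) (S : set 'cV[R]_n) :
  (volume [set (c + x)%R | x in S] <= volume S)%E.
Proof.
rewrite -[leRHS]mul1e; apply: volume_image_le => // l u lu; rewrite mul1r.
apply: (@le_trans _ _ (volume (box (c + l) (c + u)))).
  by apply: le_volume => _ [x xlu <-] i; rewrite !mxE !lerD2l.
apply: (le_trans (volume_box_le n_gt0 _)) => [i|]; first by rewrite !mxE lerD2l.
rewrite lee_fin le_eqVlt; apply/orP; left; apply/eqP.
by apply: eq_bigr => i _; rewrite !mxE opprD addrACA subrr add0r.
Qed.

Lemma volume_diag_le (R : realType) (n : nat) (n_gt0 : (0 < n)%N)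
    (d : 'rV[R]_n) (S : set 'cV[R]_n) : (forall i, 0 < d 0 i) ->
  (volume [set diag_mx d *m x | x in S]
   <= (\prod_(i < n) d 0 i)%:E * volume S)%E.
Proof.
move=> d0; apply: volume_image_le; first exact: prodr_gt0.
move=> l u lu.
apply: (@le_trans _ _ (volume (box (diag_mx d *m l) (diag_mx d *m u)))).
  by apply: le_volume => _ [x xlu <-] i; rewrite !mul_diag_mx !mxE !ler_pM2l.
apply: (le_trans (volume_box_le n_gt0 _)) => [i|].
  by rewrite !mul_diag_mx !mxE ler_pM2l.
rewrite lee_fin -big_split le_eqVlt; apply/orP; left; apply/eqP.
by apply: eq_bigr => i _ /=; rewrite !mul_diag_mx !mxE mulrBr.
Qed.

(** * Shears and unit triangular matrices *)

Lemma subdivide (R : realType) (l h x : R) (N : nat) : (0 < N)%N ->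
  l <= x <= l + N%:R * h ->
  exists2 k, (k < N)%N & l + k%:R * h <= x <= l + k.+1%:R * h.
Proof.
elim: N => // -[_ _ xlh|N IH _ /andP[lx xh]]; first by
  exists 0%N => //; rewrite mulr0n mul0r addr0.
have [xN|xN] := leP x (l + N.+1%:R * h); last by
  exists N.+1 => //; rewrite (ltW xN) xh.
have {}xN : l <= x <= l + N.+1%:R * h by rewrite lx.
by have [k kN xk] := IH isT xN; exists k => //; rewrite ltnS ltnW.
Qed.

Definition shear (R : realType) (n : nat) (i j : 'I_n) (t : R) : 'M[R]_n :=
  1%:M + t *: delta_mx i j.

Lemma shear_mulE (R : realType) (n : nat) (i j : 'I_n) (t : R)
    (x : 'cV[R]_n) k :
  (shear i j t *m x) k 0 = x k 0 + (k == i)%:R * (t * x j 0).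
Proof.
rewrite /shear mulmxDl mul1mx -scalemxAl !mxE; congr (_ + _).
rewrite (bigD1 j)//= big1 ?addr0 => [|m mj].
  by rewrite !mxE eqxx andbT mulrCA.
by rewrite !mxE (negbTE mj) andbF mul0r.
Qed.

(* Slicing the box along coordinate j into N slabs of thickness h, the image of
   each slab lies in a box whose i-th side is only 2|t|h longer. *)
Lemma volume_shear_le (R : realType) (n : nat) (n_gt0 : (0 < n)%N)
    (i j : 'I_n) (t : R) (S : set 'cV[R]_n) : i != j ->
  (volume [set shear i j t *m x | x in S] <= volume S)%E.
Proof.
move=> ij; rewrite -[leRHS]mul1e; apply: volume_image_le => // l u lu.
rewrite mul1r.
pose wj := u j 0 - l j 0.
have wj0 : 0 <= wj by rewrite subr_ge0.
pose rest := \prod_(k < n | (k != i) && (k != j)) (u k 0 - l k 0).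
have rest0 : 0 <= rest by apply: prodr_ge0 => k _; rewrite subr_ge0.
have prodE (f : 'I_n -> R) : \prod_(k < n) f k =
    f i * f j * \prod_(k < n | (k != i) && (k != j)) f k.
  by rewrite (bigD1 i)//= (bigD1 j) ?mulrA//= eq_sym.
(* [C / N] is the total excess of the [N] bounding boxes over the volume of the original box: each
   slab contributes [2 * |t| * h * h * rest], and [N * h = wj]. *)
pose C := 2 * `|t| * wj ^+ 2 * rest.
have C0 : 0 <= C by rewrite !mulr_ge0// sqr_ge0.
apply/lee_addgt0Pr => e e0.
pose N := (Num.bound (C / e)).+1.
have N0 : 0 < N%:R :> R by rewrite ltr0n.
have CN : C / N%:R <= e.
  rewrite ler_pdivrMr// mulrC -ler_pdivrMr//.
  apply: le_trans (ltW (archi_boundP _)) _; first by rewrite divr_ge0// ltW.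
  by rewrite ler_nat.
pose h := wj / N%:R.
have h0 : 0 <= h by rewrite divr_ge0// ltW.
have Nh : N%:R * h = wj by rewrite mulrC divfK// gt_eqF.
pose p (k : nat) := l j 0 + k%:R * h.
(* In slab [k] the coordinate [x j] is within [h] of [p k], so the shift [t * x j] is within
   [|t| * h] of [t * p k]. *)
pose L (k : nat) : 'cV[R]_n := \col_m (if m == j then p k else
  if m == i then l i 0 + t * p k - `|t| * h else l m 0).
pose U (k : nat) : 'cV[R]_n := \col_m (if m == j then p k.+1 else
  if m == i then u i 0 + t * p k + `|t| * h else u m 0).
have pS k : p k.+1 = p k + h by rewrite /p -natr1 mulrDl mul1r addrA.
have th0 : 0 <= `|t| * h by rewrite mulr_ge0.
have LU k m : L k m 0 <= U k m 0.
  rewrite !mxE; case: ifP => _; first by rewrite pS lerDl.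
  case: ifP => // _; have := lu i; lra.
apply: (@le_trans _ _ (volume (\bigcup_(k in `I_N) box (L k) (U k)))).
  apply: le_volume => _ [x xlu <-].
  have [k kN /andP[pk kp]] : exists2 k, (k < N)%N & p k <= x j 0 <= p k.+1.
    apply: subdivide => //; rewrite Nh /wj addrC subrK; exact: xlu.
  exists k => // m; rewrite shear_mulE !mxE.
  have [->|mj] := eqVneq m j.
    by rewrite eq_sym (negbTE ij) mul0r addr0 pk.
  have [->|mi] := eqVneq m i; last by rewrite mul0r addr0.
  have : `|t * (x j 0 - p k)| <= `|t| * h.
    rewrite normrM ler_wpM2l// ger0_norm ?subr_ge0//.
    by rewrite lerBlDl -pS.
  rewrite mul1r ler_norml => /andP[h1 h2].
  have /andP[h3 h4] := xlu i; apply/andP; split; lra.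
apply: (le_trans (volume_bigcup_box_le N n_gt0 LU)).
rewrite -EFinD lee_fin.
under eq_bigr => k _.
  rewrite prodE; under eq_bigr => m /andP[mi mj].
    rewrite !mxE (negbTE mi) (negbTE mj); over.
  rewrite -/rest !mxE (negbTE ij) !eqxx pS.
  rewrite (_ : _ * _ * rest = (u i 0 - l i 0 + 2 * `|t| * h) * h * rest);
    last by ring.
  over.
rewrite sumr_const card_ord -mulr_natl prodE -/rest -/wj.
rewrite [leLHS](_ : _ = (u i 0 - l i 0 + 2 * `|t| * h) * (N%:R * h) * rest);
  last by ring.
rewrite Nh; apply: le_trans (lerD (lexx _) CN); rewrite /C /h.
rewrite le_eqVlt; apply/orP; left; apply/eqP; ring.
Qed.

Lemma volume_mul_le (R : realType) (n : nat) (M M' : 'M[R]_n) :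
  (forall S, volume [set M *m x | x in S] <= volume S)%E ->
  (forall S, volume [set M' *m x | x in S] <= volume S)%E ->
  forall S, (volume [set M *m M' *m x | x in S] <= volume S)%E.
Proof.
move=> hM hM' S; apply: le_trans (hM' S); apply: le_trans (hM _).
apply: le_volume => _ [x Sx <-]; exists (M' *m x); last by rewrite mulmxA.
by exists x.
Qed.

Definition unit_ltriangular (R : realType) (n : nat) (L : 'M[R]_n) : Prop :=
  (forall i, L i i = 1) /\ (forall i j : 'I_n, (i < j)%N -> L i j = 0).

(** Unit lower triangular matrices are products of shears. The form of an induction principle lets
    it serve both [L] and its transpose. *)
Lemma unit_ltriangular_ind (R : realType) (n : nat) (P : 'M[R]_n -> Prop) :
  P 1%:M -> (forall M (i j : 'I_n) t, i != j -> P M -> P (M *m shear i j t)) ->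
  forall L, unit_ltriangular L -> P L.
Proof.
move=> P1 PM L [L1 L0].
(* Filling in the entries of L column by column, from top to bottom, multiplies
   on the right by one shear at a time. *)
pose A (k m : nat) : 'M[R]_n := \matrix_(i, j)
  if (j < k)%N || (j == k :> nat) && (i < m)%N then L i j else (i == j)%:R.
have -> : L = A n 0%N by apply/matrixP => i j; rewrite mxE ltn_ord.
have A0 k : P (A k 0%N) -> (k < n)%N -> forall m, (m <= n)%N -> P (A k m).
  move=> Pk kn; elim=> // m IH mn.
  pose i := Ordinal mn; pose j := Ordinal kn.
  (* On or above the diagonal, [L] agrees with the identity, so filling in the entry changes
     nothing. *)
  have [ij|ij] := leqP i j.
    suff -> : A k m.+1 = A k m by apply: IH; exact: ltnW.
    apply/matrixP => a b; rewrite !mxE.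
    case: ltnP => //= bk; have [bk'|] //= := eqVneq (b : nat) k.
    rewrite ltnS leq_eqVlt; case: ltnP => /= am; rewrite ?orbT// orbF.
    have [aE|//] := eqVneq (a : nat) m.
    have {aE} -> : a = i by exact: val_inj.
    have {bk bk'} -> : b = j by exact: val_inj.
    have [->|/negP ij'] := eqVneq i j; first by rewrite L1.
    by rewrite L0// ltn_neqAle ij andbT; apply/negP.
  have ij' : i != j by apply: contraTneq ij => ->; rewrite ltnn.
  (* The shear adds [L i j] times column [i] to column [j]. Since [i > k], column [i] is still that
     of the identity, so only entry [(i, j)] changes. *)
  rewrite (_ : A k m.+1 = A k m *m shear i j (L i j)).
    by apply: PM => //; apply: IH; exact: ltnW.
  rewrite /shear mulmxDr mulmx1 -scalemxAr.
  apply/matrixP => a b; rewrite !mxE (bigD1 i)//= big1 ?addr0; last first.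
    by move=> c ci; rewrite !mxE (negbTE ci) mulr0.
  have ik : (i < k)%N = false by rewrite ltnNge (ltnW ij : (k <= i)%N).
  have ik' : (i == k :> nat) = false by exact: gtn_eqF ij.
  rewrite !mxE eqxx ik ik' /=.
  have [bj|bj] := eqVneq b j; rewrite /= ?mulr0 ?addr0.
    rewrite bj ltnn eqxx /= ltnS leq_eqVlt mulr1.
    have [aE|am] := eqVneq (a : nat) m.
      have -> : a = i by exact: val_inj.
      by rewrite ltnn (negbTE ij') add0r eqxx mulr1.
    rewrite /= -(inj_eq val_inj a i) (negbTE am) mulr0 addr0//.
  have bk : (b == k :> nat) = false.
    by apply: contra_neqF bj => /eqP bk; apply: val_inj; rewrite /= bk.
  by rewrite bk.
have : forall k, (k <= n)%N -> P (A k 0%N).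
  elim=> [_|k IH kn].
    by rewrite (_ : A _ _ = 1%:M)//; apply/matrixP => i j; rewrite !mxE andbF.
  rewrite (_ : A _ _ = A k n); first by apply: A0 => //; apply: IH; exact: ltnW.
  apply/matrixP => i j; rewrite !mxE ltnS leq_eqVlt ltn_ord andbF orbF andbT.
  by rewrite orbC.
exact.
Qed.

Lemma volume_unit_ltriangular_le (R : realType) (n : nat) (n_gt0 : (0 < n)%N)
    (L : 'M[R]_n) (S : set 'cV[R]_n) : unit_ltriangular L ->
  (volume [set L *m x | x in S] <= volume S)%E.
Proof.
move=> Lu; move: S.
apply: (@unit_ltriangular_ind _ _
  (fun L => forall S, volume [set L *m x | x in S] <= volume S)%E) Lu.
  move=> S; rewrite (_ : (fun x => _) = id) ?image_id//.
  by apply/funext => x; rewrite mul1mx.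
move=> M i j t ij PM; apply: volume_mul_le => // S.
exact: volume_shear_le.
Qed.

Lemma shear_tr (R : realType) (n : nat) (i j : 'I_n) (t : R) :
  (shear i j t)^T = shear j i t.
Proof. by rewrite /shear linearD linearZ /= trmx1 trmx_delta. Qed.

Lemma volume_unit_utriangular_le (R : realType) (n : nat) (n_gt0 : (0 < n)%N)
    (L : 'M[R]_n) (S : set 'cV[R]_n) : unit_ltriangular L ->
  (volume [set L^T *m x | x in S] <= volume S)%E.
Proof.
move=> Lu; move: S.
apply: (@unit_ltriangular_ind _ _
  (fun L => forall S, volume [set L^T *m x | x in S] <= volume S)%E) Lu.
  move=> S; rewrite trmx1 (_ : (fun x => _) = id) ?image_id//.
  by apply/funext => x; rewrite mul1mx.
move=> M i j t ij PM; rewrite trmx_mul shear_tr; apply: volume_mul_le => // S.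
by apply: volume_shear_le => //; rewrite eq_sym.
Qed.

(** * Positivity of the volume *)

(* Induction on n: integrating over the first coordinate the inequality obtained
   for the slices.  The weights b record which boxes meet a given slice. *)
Lemma box_le_cover (R : realType) (n : nat) (l u : 'I_n -> R)
    (L U : nat -> 'I_n -> R) (b : nat -> R) :
  (forall i, l i <= u i) -> (forall k i, L k i <= U k i) ->
  (forall k, 0 <= b k) ->
  (forall x : 'I_n -> R, (forall i, l i <= x i <= u i) ->
    exists2 k, 1 <= b k & forall i, L k i <= x i <= U k i) ->
  ((\prod_(i < n) (u i - l i))%:E
   <= \sum_(0 <= k <oo) (b k * \prod_(i < n) (U k i - L k i))%:E)%E.
Proof.
elim: n => [|n IH] in l u L U b *; move=> lu LU b0 cov.
  (* In dimension 0 all products are empty and equal 1; the single point is covered, so some weight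
     is at least 1. *)
  have [|k bk _] := cov l; first by case.
  rewrite (nneseriesD1 (n := k))//; last first.
    by move=> m _; rewrite lee_fin big_ord0 mulr1.
  rewrite !big_ord0 mulr1; apply: (@le_trans _ _ (b k)%:E); first by rewrite lee_fin.
  by rewrite leeDl// nneseries_ge0// => m _ _; rewrite lee_fin big_ord0 mulr1.
pose rest k := \prod_(i < n) (U k (lift ord0 i) - L k (lift ord0 i)).
have rest0 k : 0 <= rest k by apply: prodr_ge0 => i _; rewrite subr_ge0.
pose J k : set (measurableTypeR R) := `[L k ord0, U k ord0]%classic.
pose P := \prod_(i < n) (u (lift ord0 i) - l (lift ord0 i)).
have P0 : 0 <= P by apply: prodr_ge0 => i _; rewrite subr_ge0.
pose D : set (measurableTypeR R) := `[l ord0, u ord0]%classic.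
have mD : measurable D by exact: measurable_itv.
have mJ k : measurable (J k) by exact: measurable_itv.
pose f k (x : measurableTypeR R) : \bar R :=
  ((b k * rest k)%:E * (\1_(J k) x)%:E)%E.
have mI (A : set R) (x y : R) : x <= y -> A = `[x, y]%classic ->
    lebesgue_measure A = (y - x)%:E.
  move=> xy ->; rewrite lebesgue_measure_itv/= lte_fin; case: ltP => // yx.
  have -> : x = y by apply/eqP; rewrite eq_le xy.
  by rewrite subrr.
have mf k : measurable_fun D (f k).
  apply: measurable_funeM; apply/measurable_EFinP.
  exact: measurable_indic.
have f0 k x : (0 <= f k x)%E.
  by rewrite mule_ge0// lee_fin// mulr_ge0.
(* The slice at [x] is covered by the boxes with [x] in [J k]; multiplying [b k] by the indicator of
   [J k] discards the others. *)
have slice x : D x -> (P%:E <= \sum_(0 <= k <oo) f k x)%E.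
  move=> Dx.
  have := IH (fun i => l (lift ord0 i)) (fun i => u (lift ord0 i))
    (fun k i => L k (lift ord0 i)) (fun k i => U k (lift ord0 i))
    (fun k => b k * \1_(J k) x).
  rewrite -/P => /(_ _ _ _ _)/le_trans; apply => //.
  - by move=> k; rewrite mulr_ge0.
  - move=> y yP.
    have [|k bk xk] := cov (fun i => if unlift ord0 i is Some j then y j else x).
      by move=> i; case: unliftP => [j|] ->.
    exists k.
      rewrite indicE mem_set ?mulr1//=.
      by have := xk ord0; rewrite unlift_none /J /= in_itv.
    by move=> i; have := xk (lift ord0 i); rewrite liftK.
  - apply: lee_nneseries => [k _ _|k _].
      by rewrite lee_fin mulr_ge0 ?rest0// mulr_ge0.
    by rewrite /f -EFinM mulrAC.
have -> : \prod_(i < n.+1) (u i - l i) = P * (u ord0 - l ord0).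
  by rewrite big_ord_recl mulrC.
rewrite EFinM -(mI D)// -integral_cst//.
apply: (@le_trans _ _
    (\int[lebesgue_measure]_(x in D) (\sum_(0 <= k <oo) f k x))%E).
  apply: ge0_le_integral => //.
    exact: ge0_emeasurable_sum.
rewrite integral_nneseries//.
apply: lee_nneseries => [k _ _|k _]; first exact: integral_ge0.
rewrite /f ge0_integralZl_EFin//; last 2 first.
- apply/measurable_EFinP; exact: measurable_indic.
- by rewrite mulr_ge0.
rewrite integral_indic// big_ord_recl -/(rest k) [(_ - _) * rest k]mulrC mulrA.
rewrite [leRHS]EFinM.
apply: lee_wpmul2l; first by rewrite lee_fin mulr_ge0.
rewrite -(mI (J k))//; apply: le_measure; rewrite ?inE//; exact: measurableI.
Qed.

Lemma volume_box_ge (R : realType) (n : nat) (l u : 'cV[R]_n) :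
  (forall i, l i 0 <= u i 0) ->
  ((\prod_(i < n) (u i 0 - l i 0))%:E <= volume (box l u))%E.
Proof.
move=> lu; apply/le_ereal_inf_tmp => _ [L [U [LU cov ->]]].
have := @box_le_cover R n (fun i => l i 0) (fun i => u i 0)
  (fun k i => L k i 0) (fun k i => U k i 0) (fun=> 1).
under eq_eseriesr do rewrite mul1r.
apply=> // x xlu.
have [|k _ xk] := cov (\col_i x i); first by move=> i; rewrite mxE.
by exists k => // i; have := xk i; rewrite mxE.
Qed.

Lemma enorm_le1 (R : realType) (n : nat) (x : 'cV[R]_n) :
  (enorm x <= 1) = (\sum_(i < n) x i 0 ^+ 2 <= 1).
Proof.
have s0 : 0 <= \sum_(i < n) x i 0 ^+ 2 by apply: sumr_ge0 => i _; rewrite sqr_ge0.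
by rewrite /enorm -[in LHS]sqrtr1 ler_sqrt.
Qed.

Lemma volume_unit_ball_gt0 (R : realType) (n : nat) (n_gt0 : (0 < n)%N) :
  (0 < volume (@unit_ball R n))%E.
Proof.
have n0 : 0 < n%:R :> R by rewrite ltr0n.
(* The cube of side [1/n] at the origin lies in the ball: its coordinates satisfy
   [x_i ^+ 2 <= x_i <= 1/n]. *)
pose h : R := n%:R^-1.
apply: (@lt_le_trans _ _ (\prod_(i < n) h)%:E).
  by rewrite lte_fin prodr_gt0// => i _; rewrite invr_gt0.
apply: (@le_trans _ _ (volume (box (0 : 'cV[R]_n) (const_mx h)))).
  apply: le_trans (volume_box_ge _) => [|i]; last by rewrite !mxE invr_ge0 ltW.
  by under [in leRHS]eq_bigr do rewrite !mxE subr0.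
apply: le_volume => x xh; rewrite /unit_ball /= enorm_le1.
apply: (@le_trans _ _ (\sum_(i < n) h)).
  apply: ler_sum => i _; have := xh i; rewrite !mxE => /andP[x0 x1].
  apply: le_trans (_ : x i 0 * 1 <= _); last by rewrite mulr1.
  rewrite expr2 ler_wpM2l//; apply: le_trans x1 _.
  by rewrite invf_le1// ler1n.
by rewrite sumr_const card_ord -mulr_natl mulfV// gt_eqF.
Qed.

(** The ball lies in the cube with sides from -1 to 1. Finiteness and positivity together allow the
    ball volume to be cancelled when ellipsoids are compared. *)
Lemma volume_unit_ball_fin (R : realType) (n : nat) (n_gt0 : (0 < n)%N) :
  volume (@unit_ball R n) \is a fin_num.
Proof.
rewrite ge0_fin_numE ?volume_ge0//.
apply: (@le_lt_trans _ _ (volume (box (const_mx (-1) : 'cV[R]_n) (const_mx 1)))).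
  apply: le_volume => x; rewrite /unit_ball /= enorm_le1 => x1 i; rewrite !mxE.
  have {x1} : x i 0 ^+ 2 <= 1.
    apply: le_trans x1.
    by rewrite (bigD1 i)//= lerDl sumr_ge0// => j _; rewrite sqr_ge0.
  by rewrite -real_normK ?num_real// expr_le1// ler_norml.
apply: le_lt_trans (volume_box_le n_gt0 _) _ => [i|]; last exact: ltry.
by rewrite !mxE; lra.
Qed.

(** * LDL decomposition and volumes of ellipsoids *)

Lemma block_unit_ltriangular (R : realType) (n : nat) (v : 'cV[R]_n)
    (L : 'M[R]_n) : unit_ltriangular L ->
  unit_ltriangular (block_mx 1%:M 0 v L : 'M[R]_(1 + n)).
Proof.
move=> [L1 L0]; split=> [i|i j].
  case: (split_ordP i) => k ->; first by rewrite block_mxEul !mxE eqxx.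
  by rewrite block_mxEdr.
case: (split_ordP i) => a ->; case: (split_ordP j) => b ->.
- by rewrite !ord1 ltnn.
- by rewrite block_mxEur mxE.
- by rewrite /= ltnNge ltnW// (leq_trans (ltn_ord b)) ?leq_addr.
- by rewrite block_mxEdr /= ltn_add2l; exact: L0.
Qed.

Lemma sym_posdef_diag_gt0 (R : realType) (n : nat) (A : 'M[R]_n) i :
  sym_posdef A -> 0 < A i i.
Proof.
move=> [_ A0]; have /A0 : delta_mx i 0 != 0 :> 'cV[R]_n.
  apply/eqP => /matrixP/(_ i 0)/eqP; rewrite !mxE !eqxx/=.
  by rewrite oner_eq0.
by rewrite trmx_delta -rowE -colE !mxE.
Qed.

(* Gaussian elimination: the Schur complement of a positive definite matrix is
   positive definite. *)
Lemma sym_posdef_LDL (R : realType) (n : nat) (A : 'M[R]_n) : sym_posdef A ->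
  exists (L : 'M[R]_n) (d : 'rV[R]_n),
    [/\ unit_ltriangular L, forall i, 0 < d 0 i & A = L *m diag_mx d *m L^T].
Proof.
elim: n => [|n IH] in A *.
  move=> _; exists 1%:M, 0; split; first by split; case.
    by case.
  by apply/matrixP => -[].
move=> Apd; have m0 : 0 < A 0 0 by exact: sym_posdef_diag_gt0.
case: Apd; rewrite -[n.+1]/(1 + n)%N in A m0 *.
rewrite -[A]submxK; set m := ulsubmx A; set v := dlsubmx A; set N := drsubmx A.
rewrite tr_block_mx => /eq_block_mx[_ _ vE Nsym] Apd.
have mE : m = (A 0 0)%:M.
  by rewrite [m]mx11_scalar !mxE; congr ((A _ _)%:M); exact: val_inj.
have vE' : ursubmx A = v^T by rewrite -vE trmxK.
rewrite vE' mE in Apd *.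
set a := A 0 0 in m0 Apd *.
have an0 : a != 0 by rewrite gt_eqF.
pose w := a^-1 *: v.
have vw : v = a *: w by rewrite /w scalerA mulfV// scale1r.
have vTw : v^T = a *: w^T by rewrite vw linearZ.
clearbody w.
pose S := N - a *: (w *m w^T).
have Spd : sym_posdef S.
  split.
    by rewrite /S linearB linearZ /= trmx_mul trmxK Nsym.
  move=> y y0.
  (* For given [y], this choice of the first coordinate minimises the quadratic form of the block
     matrix, and the minimum is the form of [S] at [y]. *)
  have /Apd : col_mx (- (w^T *m y)) y != 0.
    by apply: contra_neq y0 => /(congr1 dsubmx); rewrite col_mxKd linear0.
  congr (0 < _).
  suff -> : (col_mx (- (w^T *m y)) y)^T *m block_mx a%:M v^T v N
     *m col_mx (- (w^T *m y)) y = y^T *m S *m y by [].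
  rewrite tr_col_mx mul_row_block mul_row_col /S.
  have -> : (- (w^T *m y))^T = - (y^T *m w) by rewrite linearN /= trmx_mul trmxK.
  rewrite vTw vw -!scalemxAr mul_mx_scalar scalerN addNr mul0mx add0r.
  congr (_ *m _).
  by rewrite mulNmx scalerN addrC mulmxBr -scalemxAr mulmxA.
have [L [d [Lu d0 SE]]] := IH S Spd.
exists (block_mx 1%:M 0 w L), (row_mx a%:M d); split.
- exact: block_unit_ltriangular.
- move=> i; case: (split_ordP i) => k ->; last by rewrite row_mxEr.
  by rewrite row_mxEl ord1 mxE eqxx.
rewrite diag_mx_row tr_block_mx !mulmx_block.
rewrite !(mul0mx, mulmx0, mul1mx, mulmx1, addr0, add0r, trmx0, trmx1).
have -> : diag_mx (a%:M : 'rV[R]_1) = a%:M.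
  by apply/matrixP => i j; rewrite !mxE !ord1 eqxx !mulr1n.
rewrite mul_scalar_mx mul_mx_scalar -scalemxAl -SE vTw vw /S.
by rewrite addrC subrK.
Qed.

(** The diagonal entry is [d_i] plus the sum over [k != i] of [L_ik ^+ 2 * d_k]. *)
Lemma LDL_diag_ge (R : realType) (n : nat) (L : 'M[R]_n) (d : 'rV[R]_n) i :
  unit_ltriangular L -> (forall i, 0 < d 0 i) ->
  d 0 i <= (L *m diag_mx d *m L^T) i i.
Proof.
move=> [L1 _] d0; rewrite mxE (bigD1 i)//= mul_mx_diag !mxE L1 mul1r mulr1.
rewrite lerDl sumr_ge0// => k _.
by rewrite !mxE mulrAC -expr2 mulr_ge0 ?sqr_ge0 ?(ltW (d0 _)).
Qed.

(** In the same expansion, equality makes a sum of nonnegative terms vanish, so every off-diagonal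
    [L_ij] is 0. *)
Lemma LDL_diag_eq (R : realType) (n : nat) (L : 'M[R]_n) (d : 'rV[R]_n) :
  unit_ltriangular L -> (forall i, 0 < d 0 i) ->
  (forall i, (L *m diag_mx d *m L^T) i i = d 0 i) -> L = 1%:M.
Proof.
move=> [L1 L0] d0 dE; apply/matrixP => i j; rewrite !mxE.
have [<-|ij] := eqVneq i j; first by rewrite L1.
have := dE i; rewrite mxE (bigD1 i)//= mul_mx_diag !mxE L1 mul1r mulr1.
rewrite -[RHS]addr0 => /addrI /eqP; rewrite psumr_eq0 => [|k _]; last first.
  by rewrite !mxE mulrAC -expr2 mulr_ge0 ?sqr_ge0 ?(ltW (d0 _)).
move/allP => /(_ j (mem_index_enum _)); rewrite eq_sym ij /= !mxE.
by rewrite !mulf_eq0 (gt_eqF (d0 j)) orbF orbb => /eqP.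
Qed.

Lemma volume_ellipsoid_le (R : realType) (n : nat) (n_gt0 : (0 < n)%N)
    (c : 'cV[R]_n) (L : 'M[R]_n) (d : 'rV[R]_n) :
  unit_ltriangular L -> (forall i, 0 < d 0 i) ->
  (volume (ellipsoid c (L *m diag_mx d *m L^T))
   <= (\prod_(i < n) d 0 i)%:E * volume (@unit_ball R n))%E.
Proof.
move=> Lu d0; pose B := @unit_ball R n.
pose S1 := [set L^T *m x | x in B]; pose S2 := [set diag_mx d *m x | x in S1].
pose S3 := [set L *m x | x in S2].
apply: (@le_trans _ _ (volume [set (c + x)%R | x in S3])).
  apply: le_volume => _ [x Bx <-].
  exists (L *m (diag_mx d *m (L^T *m x))); last by rewrite !mulmxA.
  by do 3 (eexists; last reflexivity).
apply: (le_trans (volume_translate_le _ _ _)) => //.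
apply: (le_trans (volume_unit_ltriangular_le _ _ _)) => //.
apply: (le_trans (volume_diag_le _ _ _)) => //.
apply: lee_wpmul2l; first by rewrite lee_fin prodr_ge0// => i _; exact: ltW.
exact: volume_unit_utriangular_le.
Qed.

(** The ball is recovered from the ellipsoid by a translation and the inverse diagonal map, so the
    upper bounds for images, applied to these, give a lower bound here. *)
Lemma volume_diag_ellipsoid_ge (R : realType) (n : nat) (n_gt0 : (0 < n)%N)
    (c : 'cV[R]_n) (d : 'rV[R]_n) : (forall i, 0 < d 0 i) ->
  ((\prod_(i < n) d 0 i)%:E * volume (@unit_ball R n)
   <= volume (ellipsoid c (diag_mx d)))%E.
Proof.
move=> d0; pose d' : 'rV[R]_n := \row_i (d 0 i)^-1.
have P0 : 0 < \prod_(i < n) d 0 i by exact: prodr_gt0.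
pose E := ellipsoid c (diag_mx d).
have -> : @unit_ball R n =
    [set diag_mx d' *m x | x in [set (- c + x)%R | x in E]].
  have inv (x : 'cV[R]_n) : diag_mx d' *m (- c + (c + diag_mx d *m x)) = x.
    rewrite addKr mulmxA; apply/matrixP => i j.
    rewrite mulmx_diag mul_diag_mx !mxE mulVf ?mul1r// gt_eqF//.
  apply/seteqP; split => [x Bx|_ [_ [_ [x Bx <-] <-] <-]]; last by rewrite inv.
  exists (- c + (c + diag_mx d *m x)) => //.
  by exists (c + diag_mx d *m x) => //; exists x.
rewrite -lee_pdivlMl//; apply: (le_trans (volume_diag_le _ _ _)) => //.
  by move=> i; rewrite mxE invr_gt0.
have -> : \prod_(i < n) d' 0 i = (\prod_(i < n) d 0 i)^-1.
  by rewrite -prodfV; apply: eq_bigr => i _; rewrite mxE.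
apply: lee_wpmul2l; first by rewrite lee_fin invr_ge0 ltW.
exact: volume_translate_le.
Qed.

(** * AM-GM and test points of the unit ball *)

Lemma prod_le1_AGM (R : realType) (n : nat) (r : 'I_n -> R) :
  (forall i, 0 <= r i) -> \sum_(i < n) r i <= n%:R ->
  \prod_(i < n) r i <= 1 /\ (1 <= \prod_(i < n) r i -> forall i, r i = 1).
Proof.
case: n r => [|n] r r0 rs; first by rewrite big_ord0; split => // _ [].
have [agm agmE] := leif_AGM (A := predT) (E := r) (fun i _ => r0 i).
rewrite cardT size_enum_ord in agm agmE.
have mean1 : (\sum_(i < n.+1) r i) / n.+1%:R <= 1.
  by rewrite ler_pdivrMr ?ltr0n// mul1r.
have mean0 : 0 <= (\sum_(i < n.+1) r i) / n.+1%:R by rewrite divr_ge0// sumr_ge0.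
have pow1 : ((\sum_(i < n.+1) r i) / n.+1%:R) ^+ n.+1 <= 1 by rewrite exprn_ile1.
split=> [|pge1]; first exact: le_trans agm pow1.
(* A product at least 1 is squeezed against a mean at most 1: AM-GM is an equality, so all [r i]
   agree, and their mean is 1. *)
have eqA : (\prod_(i < n.+1) r i == ((\sum_(i < n.+1) r i) / n.+1%:R) ^+ n.+1).
  by rewrite eq_le agm (le_trans pow1).
have /forall_inP rall : is_true _ := etrans (esym agmE) eqA; move=> i.
have rE j : r j = r i by have /forall_inP/(_ i isT)/eqP := rall j isT.
have : (\sum_(i < n.+1) r i) / n.+1%:R == 1.
  by rewrite -(@pexpr_eq1 _ _ n.+1)// eq_le pow1 (le_trans pge1).
rewrite (eq_bigr _ (fun j _ => rE j)) sumr_const card_ord -(mulr_natl (r i)).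
by rewrite mulrAC mulfV ?mul1r ?pnatr_eq0// => /eqP.
Qed.

Lemma unit_ball_delta (R : realType) (n : nat) (i : 'I_n) (x : R) :
  x ^+ 2 <= 1 -> unit_ball (x *: delta_mx i 0 : 'cV[R]_n).
Proof.
move=> x1; rewrite /unit_ball /= enorm_le1 (bigD1 i)//= big1 => [|k ki].
  by rewrite !mxE !eqxx mulr1 addr0.
by rewrite !mxE (negbTE ki) mulr0 expr0n.
Qed.

Lemma unit_ball_delta2 (R : realType) (n : nat) (i j : 'I_n) (x y : R) :
  i != j -> x ^+ 2 + y ^+ 2 <= 1 ->
  unit_ball (x *: delta_mx i 0 + y *: delta_mx j 0 : 'cV[R]_n).
Proof.
move=> ij xy1; rewrite /unit_ball /= enorm_le1 (bigD1 i)//= (bigD1 j) 1?eq_sym//=.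
rewrite big1 => [|k /andP[ki kj]].
  by rewrite !mxE !eqxx (negbTE ij) eq_sym (negbTE ij) !mulr1 !mulr0 !addr0 add0r.
by rewrite !mxE (negbTE ki) (negbTE kj) !mulr0 addr0 expr0n.
Qed.

Lemma mul_delta_col (R : realType) (n : nat) (A : 'M[R]_n) (i k : 'I_n) :
  (A *m (delta_mx i 0 : 'cV_n)) k 0 = A k i.
Proof. by rewrite -colE mxE. Qed.

(** * Optimality *)

Section Slab.
Context (R : realType) (n : nat) (n_gt0 : (0 < n)%N).
Implicit Types (alpha beta : R) (c : 'cV[R]_n) (A : 'M[R]_n).
Let o : 'I_n := Ordinal n_gt0.

(** The two inequalities come from the images of [e_1] and [- e_1]. *)
Lemma ellipsoid_slab_width alpha beta c A :
  ellipsoid c A `<=` ball_slab n_gt0 alpha beta ->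
  A o o <= c o 0 - alpha /\ A o o <= beta - c o 0.
Proof.
move=> AK.
have pt (x : R) : x ^+ 2 <= 1 -> alpha <= c o 0 + x * A o o <= beta.
  move=> /(unit_ball_delta o) Bx; have [] := AK (c + A *m (x *: delta_mx o 0)).
    by exists (x *: delta_mx o 0).
  by move=> _; rewrite -scalemxAr mxE [X in _ + X]mxE mul_delta_col.
have /andP[_ h1] : alpha <= c o 0 + 1 * A o o <= beta by rewrite pt ?expr1n.
have /andP[h2 _] : alpha <= c o 0 + (-1) * A o o <= beta by rewrite pt ?sqrrN ?expr1n.
by split; lra.
Qed.

(** The half-space [s * x_o + r * x_i <= 1] supports the unit ball at the unit vector with
    coordinates [s] and [r]; it is evaluated at the image of [q e_1 + p e_i]. *)
Lemma ellipsoid_ball_contact alpha beta c A i (p q r s : R) : i != o ->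
  q ^+ 2 + p ^+ 2 = 1 -> s ^+ 2 + r ^+ 2 = 1 ->
  ellipsoid c A `<=` ball_slab n_gt0 alpha beta ->
  s * (c o 0 + q * A o o + p * A o i) + r * (c i 0 + q * A i o + p * A i i) <= 1.
Proof.
move=> io qp sr AK.
pose u : 'cV[R]_n := q *: delta_mx o 0 + p *: delta_mx i 0.
have uB : unit_ball u by apply: unit_ball_delta2; rewrite 1?eq_sym ?qp.
have uE k : (c + A *m u) k 0 = c k 0 + q * A k o + p * A k i.
  rewrite /u mulmxDr -!scalemxAr mxE [X in _ + X]mxE !addrA.
  by congr (_ + _ + _); rewrite mxE mul_delta_col.
have [] := AK (c + A *m u); first by exists u.
rewrite enorm_le1 (bigD1 o)//= (bigD1 i)//= addrA !uE => h _.
set x := c o 0 + _ + _ in h *; set y := c i 0 + _ + _ in h *.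
have {h} xy : x ^+ 2 + y ^+ 2 <= 1.
  by apply: le_trans h; rewrite lerDl sumr_ge0// => k _; exact: sqr_ge0.
have := sqr_ge0 (s - x); have := sqr_ge0 (r - y).
by rewrite !sqrrB; lra.
Qed.

End Slab.

(* With [p ^+ 2 = 1 - q ^+ 2] and [s = tau + a * q], the ellipsoid
   tau e_1 + diag(a, b, ..., b) B touches the unit sphere at the points
   (s, b p w), |w| = 1, which are the images of the points (q, p w). *)
Record optimal_shape (R : realType) (n : nat) (alpha beta tau a b q : R) :
    Prop := OptimalShape {
  shape_a_gt0 : 0 < a;
  shape_ab : a <= b;
  shape_q_ge0 : 0 <= q;
  shape_nq : n%:R * q <= 1;
  shape_tangent : a * tau = q * (b ^+ 2 - a ^+ 2);
  shape_sphere : (tau + a * q) ^+ 2 + b ^+ 2 * (1 - q ^+ 2) = 1;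
  shape_alpha : tau - a = alpha;
  shape_beta : tau + a <= beta;
  shape_active : tau + a = beta \/ n%:R * q = 1 /\ (1 < n)%N
}.

(** * An optimal shape gives the unique maximiser *)

Section Optimality.
Context (R : realType) (n : nat) (n_gt0 : (0 < n)%N).
Context (alpha beta tau a b q : R).
Context (shape : optimal_shape n alpha beta tau a b q).
Let o : 'I_n := Ordinal n_gt0.
Let D : 'rV[R]_n := \row_i (if i == o then a else b).
Let E := ellipsoid (tau *: e1 R n_gt0) (diag_ab n_gt0 a b).
Let K := ball_slab n_gt0 alpha beta.

Let a_gt0 : 0 < a. Proof. by case: shape. Qed.
Let b_gt0 : 0 < b. Proof. by case: shape => a0 ab *; exact: lt_le_trans ab. Qed.
Let q_ge0 : 0 <= q. Proof. by case: shape. Qed.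

Let D_gt0 i : 0 < D 0 i. Proof. by rewrite mxE; case: ifP. Qed.

Let q_le1 : q <= 1.
Proof.
case: shape => _ _ q0 nq _ _ _ _ _; apply: le_trans nq.
by rewrite ler_peMl// ler1n.
Qed.

Lemma optimal_ellipsoid_sub : E `<=` K.
Proof.
move=> _ [u uB <-]; move: uB; rewrite /unit_ball /= enorm_le1 => uB.
set x := _ + _.
have xo : x o 0 = tau + a * u o 0.
  by rewrite /x mul_diag_mx !mxE !eqxx mulr1.
have xi i : i != o -> x i 0 = b * u i 0.
  by move=> io; rewrite /x mul_diag_mx !mxE (negbTE io) mulr0 add0r.
have [a0 ab q0 nq tang sph al be _] := shape.
set v := u o 0 in xo; pose w := \sum_(i < n | i != o) u i 0 ^+ 2.
have w0 : 0 <= w by apply: sumr_ge0 => i _; exact: sqr_ge0.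
have vw : v ^+ 2 + w <= 1 by rewrite (bigD1 o) in uB.
split.
  rewrite enorm_le1 (bigD1 o)//= xo.
  have -> : \sum_(i < n | i != o) x i 0 ^+ 2 = b ^+ 2 * w.
    by rewrite mulr_sumr; apply: eq_bigr => i io; rewrite xi// exprMn.
  have : b ^+ 2 * w <= b ^+ 2 * (1 - v ^+ 2).
    by apply: ler_wpM2l; [exact: sqr_ge0 | lra].
  (* For [u] on the unit sphere with first coordinate [v], the slack [1 - |x|^2] is quadratic in
     [v]. The tangency and sphere conditions make [q] a double root, so the slack equals this square
     term. *)
  have : 0 <= (b ^+ 2 - a ^+ 2) * (v - q) ^+ 2.
    by rewrite mulr_ge0 ?sqr_ge0// subr_ge0 lerXn2r ?nnegrE// ltW.
  have -> : (b ^+ 2 - a ^+ 2) * (v - q) ^+ 2 =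
     1 - (tau + a * v) ^+ 2 - b ^+ 2 * (1 - v ^+ 2)
     + 2 * (v - q) * (a * tau - q * (b ^+ 2 - a ^+ 2))
     + ((tau + a * q) ^+ 2 + b ^+ 2 * (1 - q ^+ 2) - 1) by ring.
  by rewrite tang sph; lra.
have : -1 <= v <= 1.
  have v1 : v ^+ 2 <= 1 by lra.
  by move: v1; rewrite -real_normK ?num_real// expr_le1// ler_norml.
move=> /andP[v1 v2]; rewrite -/o xo; apply/andP; split; nra.
Qed.

(** To be read with [k = n - 1], [x = A_11] and [t = c_1]; the quotient multiplied by [k] is the
    bound on [A_ii / b] given by the sphere contacts. After the plane at [alpha] is used, what
    remains is a multiple of [(1 - n q) * (a - x)]: either the first factor is 0, or the plane at
    [beta] is touched and both planes give [x <= a]. *)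
Let diag_ineq (k x t : R) : 1 <= k -> (k + 1) * q <= 1 -> q < 1 ->
  tau + a = beta \/ (k + 1) * q = 1 ->
  x <= t - alpha -> x <= beta - t ->
  x / a + k * ((1 - (tau + a * q) * (t + q * x)) / (b ^+ 2 * (1 - q ^+ 2)))
   <= k + 1.
Proof.
move=> k1 kq q1 act xt1 xt2.
have [a0 ab q0 nq tang sph al be _] := shape.
set Q := b ^+ 2 * (1 - q ^+ 2) in sph *.
have Q0 : 0 < Q by rewrite mulr_gt0// ?exprn_gt0// subr_gt0 expr_lt1.
rewrite -subr_ge0.
have -> : k + 1 - (x / a + k * ((1 - (tau + a * q) * (t + q * x)) / Q)) =
  ((k + 1) * a * Q - x * Q - k * (a * (1 - (tau + a * q) * (t + q * x)))) / (a * Q).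
  by field; rewrite !gt_eqF.
apply: divr_ge0; last by rewrite mulr_ge0// ltW.
have as_ : a * (tau + a * q) = q * b ^+ 2 by rewrite mulrDr tang; ring.
have -> : (k + 1) * a * Q - x * Q - k * (a * (1 - (tau + a * q) * (t + q * x))) =
  (a - x) * Q - k * (a * (tau + a * q)) * (tau - t + q * (a - x))
  + k * a * ((tau + a * q) ^+ 2 + Q - 1) by ring.
rewrite as_ sph subrr mulr0 addr0 /Q.
have -> : (a - x) * (b ^+ 2 * (1 - q ^+ 2))
    - k * (q * b ^+ 2) * (tau - t + q * (a - x)) =
  b ^+ 2 * ((a - x) * (1 - q) * (1 + q) - k * q * (tau - t + q * (a - x))) by ring.
apply: mulr_ge0; first exact: sqr_ge0.
have TX : tau - t <= a - x by lra.
have kq0 : 0 <= k * q by rewrite mulr_ge0//; lra.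
have h1 : k * q * (tau - t + q * (a - x)) <= k * q * ((1 + q) * (a - x)).
  by apply: ler_wpM2l => //; lra.
have h2 : 0 <= (1 - q - k * q) * ((1 + q) * (a - x)).
  case: act => [tb|kq1]; last by rewrite (_ : 1 - q - k * q = 0) ?mul0r//; lra.
  by apply: mulr_ge0; [lra | apply: mulr_ge0; lra].
by lra.
Qed.

Let p := Num.sqrt (1 - q ^+ 2).

Let p2 : p ^+ 2 = 1 - q ^+ 2.
Proof. by rewrite sqr_sqrtr// subr_ge0 expr_le1. Qed.

Let qp : q ^+ 2 + p ^+ 2 = 1. Proof. by rewrite p2; ring. Qed.

Let sr : (tau + a * q) ^+ 2 + (b * p) ^+ 2 = 1.
Proof. by case: shape => _ _ _ _ _ <- _ _ _; rewrite exprMn p2. Qed.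

Let q_lt1 : (1 < n)%N -> q < 1.
Proof.
case: shape => _ _ _ nq _ _ _ _ _ n1.
have : 2 <= n%:R :> R by rewrite ler_nat.
nra.
Qed.

(** Averaging the contact conditions at [(q, p)] and [(q, - p)] cancels [c_i], [A_oi] and [A_io]. *)
Lemma inscribed_diag_entry c A i : i != o -> ellipsoid c A `<=` K ->
  (tau + a * q) * (c o 0 + q * A o o) + b * p ^+ 2 * A i i <= 1.
Proof.
move=> io AK.
have h1 := ellipsoid_ball_contact io qp sr AK.
have := ellipsoid_ball_contact (p := - p) (r := - (b * p)) io _ _ AK.
rewrite !sqrrN => /(_ _ _ qp sr); rewrite -/o in h1 *.
by lra.
Qed.

Lemma inscribed_trace_le c A : ellipsoid c A `<=` K ->
  \sum_(i < n) A i i / D 0 i <= n%:R.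
Proof.
move=> AK; rewrite (bigD1 o)//= mxE eqxx.
have [x1 x2] := ellipsoid_slab_width AK.
have [a0 ab q0 nq tang sph al be act] := shape.
pose k : R := n.-1%:R.
have nk : n%:R = k + 1 by rewrite natr1 prednK.
(* In dimension 1 there is no latitude circle; the shape touches both planes, and the width
   conditions alone give [A_11 <= a]. *)
have [n1|n1] := leqP n 1.
  rewrite big1 => [|i]; last first.
    rewrite -(inj_eq val_inj) /= -lt0n => i0.
    by have := leq_trans (ltn_ord i) n1; rewrite ltnS leqn0 eqn0Ngt i0.
  have nE : n = 1%N by apply/eqP; rewrite eqn_leq n1.
  case: act => [tb|[_]]; last by rewrite ltnNge n1.
  have -> : n%:R = 1 :> R by rewrite nE.
  by rewrite addr0 ler_pdivrMr// -/o; lra.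
have q1 := q_lt1 n1.
have k1 : 1 <= k by rewrite ler1n -ltnS prednK.
set g := (1 - (tau + a * q) * (c o 0 + q * A o o)) / (b ^+ 2 * (1 - q ^+ 2)).
apply: (@le_trans _ _ (A o o / a + k * g)); last first.
  rewrite nk; apply: diag_ineq => //; rewrite -?nk//.
  by case: act => [|[]]; [left|right].
rewrite lerD2l; apply: (@le_trans _ _ (\sum_(i < n | i != o) g)).
  apply: ler_sum => i io; rewrite mxE (negbTE io) /g -p2.
  have p0 : 0 < p ^+ 2 by rewrite p2 subr_gt0 expr_lt1.
  rewrite ler_pdivlMr; last by rewrite mulr_gt0// exprn_gt0.
  have := inscribed_diag_entry io AK.
  have -> : A i i / b * (b ^+ 2 * p ^+ 2) = b * p ^+ 2 * A i i.
    by field; rewrite gt_eqF.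
  by lra.
by rewrite sumr_const cardC1 card_ord mulr_natl.
Qed.

Lemma optimal_ellipsoid_is_ellipsoid : is_ellipsoid E.
Proof.
exists (tau *: e1 R n_gt0), (diag_ab n_gt0 a b); split => //; split.
  by rewrite /diag_ab tr_diag_mx.
move=> x /cV0Pn[i xi]; rewrite /diag_ab -mulmxA mxE (bigD1 i)//=.
apply: ltr_pwDl; last first.
  apply: sumr_ge0 => j _; rewrite mul_diag_mx !mxE mulrCA mulr_ge0 ?sqr_ge0//.
  by have := D_gt0 j; rewrite mxE => /ltW.
rewrite mul_diag_mx !mxE mulrCA mulr_gt0//; last by rewrite -expr2 exprn_even_gt0.
by have := D_gt0 i; rewrite mxE.
Qed.

Lemma inscribed_prod_le c A : sym_posdef A -> ellipsoid c A `<=` K ->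
  \prod_(i < n) A i i <= \prod_(i < n) D 0 i /\
  (\prod_(i < n) D 0 i <= \prod_(i < n) A i i -> forall i, A i i = D 0 i).
Proof.
move=> Apd AK.
have [|h1 h2] := prod_le1_AGM _ (inscribed_trace_le AK).
  by move=> i; rewrite divr_ge0 ?ltW// ?sym_posdef_diag_gt0.
have P0 : 0 < \prod_(i < n) D 0 i by exact: prodr_gt0.
move: h1 h2; rewrite big_split/= prodfV ler_pdivrMr// mul1r => h1 h2; split => //.
rewrite ler_pdivlMr// mul1r in h2 => /h2 + i => /(_ i) /(congr1 ( *%R^~ (D 0 i))).
by rewrite divfK ?mul1r// gt_eqF.
Qed.

Lemma inscribed_volume_le c A : sym_posdef A -> ellipsoid c A `<=` K ->
  (volume (ellipsoid c A) <= volume E)%E /\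
  ((volume E <= volume (ellipsoid c A))%E -> A = diag_ab n_gt0 a b).
Proof.
move=> Apd AK; have [L [d [Lu d0 AE]]] := sym_posdef_LDL Apd.
have dA i : d 0 i <= A i i by rewrite AE; exact: LDL_diag_ge.
have pdA : \prod_(i < n) d 0 i <= \prod_(i < n) A i i.
  by apply: ler_prod => i _; rewrite dA ltW.
have [pAD AD] := inscribed_prod_le Apd AK.
have volA : (volume (ellipsoid c A) <=
    (\prod_(i < n) d 0 i)%:E * volume (@unit_ball R n))%E.
  by rewrite AE; exact: volume_ellipsoid_le.
have volE := volume_diag_ellipsoid_ge n_gt0 (tau *: e1 R n_gt0) D_gt0.
have B0 := volume_unit_ball_gt0 R n_gt0.
have Bfin := volume_unit_ball_fin R n_gt0.
split.
  apply: le_trans volE; apply: (le_trans volA).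
  by apply: lee_wpmul2r; [exact: ltW | rewrite lee_fin (le_trans pdA)].
move=> EA.
(* Equality of volumes closes the chain [prod d <= prod A_ii <= prod D], so both links are
   equalities. *)
have pDd : \prod_(i < n) D 0 i <= \prod_(i < n) d 0 i.
  have := le_trans volE (le_trans EA volA).
  by rewrite -(fineK Bfin) -!EFinM lee_fin ler_pM2r// fine_gt0// B0 ltey_eq Bfin.
have {}AD := AD (le_trans pDd pdA).
have A0 i : 0 < A i i by exact: sym_posdef_diag_gt0.
have PA0 : 0 < \prod_(i < n) A i i by exact: prodr_gt0.
(* The ratios are at most 1 and their product is at least 1, so each is 1. *)
have [||_] := @prod_le1_AGM _ n (fun i => d 0 i / A i i).
- by move=> i; rewrite divr_ge0// ltW.
- have -> : n%:R = \sum_(i < n) 1 :> R by rewrite sumr_const card_ord.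
  by apply: ler_sum => i _; rewrite ler_pdivrMr// mul1r.
rewrite big_split/= prodfV ler_pdivlMr// mul1r => /(_ (le_trans pAD pDd)) dA1.
have {}dA i : A i i = d 0 i.
  by have /(congr1 ( *%R^~ (A i i))) := dA1 i; rewrite divfK ?mul1r// gt_eqF.
have L1 : L = 1%:M by apply: (LDL_diag_eq Lu d0) => i; rewrite -AE.
rewrite AE L1 trmx1 mulmx1 mul1mx /diag_ab; congr diag_mx.
by apply/rowP => i; rewrite -dA AD.
Qed.

Lemma inscribed_center c : ellipsoid c (diag_ab n_gt0 a b) `<=` K ->
  c = tau *: e1 R n_gt0.
Proof.
set A := diag_ab _ _ _ => AK.
have AE i j : A i j = (if i == o then a else b) *+ (i == j).
  by rewrite !mxE.
have [a0 ab q0 nq tang sph al be act] := shape.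
have [x1 x2] := ellipsoid_slab_width AK.
rewrite -/o AE eqxx mulr1n in x1 x2.
have co : c o 0 = tau.
  (* If both planes are touched, they fix [c_1]. Otherwise the plane at [alpha] gives [c_1 >= tau],
     and the circle contact, whose normal has positive first coordinate [tau + a * q], gives the
     reverse. *)
  case: act => [tb|[nq1 n1]]; first by lra.
  have io : Ordinal n1 != o by [].
  have := inscribed_diag_entry io AK; rewrite !AE !eqxx (negbTE io) !mulr1n => h.
  have s0 : 0 < tau + a * q.
    rewrite -(pmulr_rgt0 _ a0) mulrDr tang.
    have -> : q * (b ^+ 2 - a ^+ 2) + a * (a * q) = q * b ^+ 2 by ring.
    rewrite mulr_gt0 ?exprn_gt0// lt_neqAle q0 andbT.
    by apply: contra_eq_neq nq1 => <-; rewrite mulr0 eq_sym oner_neq0.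
  apply/eqP; rewrite eq_le; apply/andP; split; last by lra.
  rewrite -(ler_pM2l s0).
  have := sph; rewrite -p2; lra.
apply/colP => i; rewrite !mxE; have [->|io] := eqVneq i o.
  by rewrite co eqxx mulr1.
rewrite /= mulr0.
have n1 : (1 < n)%N.
  rewrite ltnNge; apply: contra io => n1.
  rewrite -(inj_eq val_inj)/=; have := leq_trans (ltn_ord i) n1.
  by rewrite ltnS leqn0.
have p0 : 0 < p by rewrite sqrtr_gt0 subr_gt0 expr_lt1 ?q_lt1.
(* The two opposite contact points in direction [i] bound [b * p * c_i] by 0 from above and from
   below. *)
have h1 := ellipsoid_ball_contact io qp sr AK.
have := ellipsoid_ball_contact (p := - p) (r := - (b * p)) io _ _ AK.
rewrite !sqrrN => /(_ _ _ qp sr); rewrite -/o in h1 *.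
rewrite !AE !eqxx (negbTE io) (eq_sym o) (negbTE io) co /=
  !mulr0n !mulr1n in h1 * => h2.
have bp0 : 0 < b * p by rewrite mulr_gt0.
have sph' := sr.
apply/eqP; rewrite eq_le -(ler_pM2l bp0) -[X in _ && X](ler_pM2l bp0).
by apply/andP; split; lra.
Qed.

Lemma optimal_ellipsoid_is_IE : is_IE K E.
Proof.
split; first split.
- exact: optimal_ellipsoid_is_ellipsoid.
- exact: optimal_ellipsoid_sub.
- by move=> _ [c [A [Apd ->]]] AK; have [] := inscribed_volume_le Apd AK.
move=> _ [[c [A [Apd ->]]] AK Amax].
have [_ AE] := inscribed_volume_le Apd AK.
have {}AE : A = diag_ab n_gt0 a b.
  apply/AE/Amax; first exact: optimal_ellipsoid_is_ellipsoid.
  exact: optimal_ellipsoid_sub.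
by rewrite AE in AK *; rewrite (inscribed_center AK).
Qed.

End Optimality.

(** * The three cases *)

Lemma ler_sqr_addr_ge0 (R : realType) (alpha beta : R) :
  alpha < beta -> (alpha ^+ 2 <= beta ^+ 2) = (0 <= beta + alpha).
Proof. by move=> ab; rewrite -subr_ge0 subr_sqr pmulr_rge0// subr_gt0. Qed.

(** Here [q = 0]: the ellipsoid is centred at the origin and touches the sphere along the
    equator. *)
Lemma symmetric_slab_shape (R : realType) (n : nat) (beta : R) :
  0 < beta -> beta <= 1 -> optimal_shape n (- beta) beta 0 beta 1 0.
Proof. by move=> b0 b1; split=> //; rewrite ?mulr0 ?expr0n /=; try left; lra. Qed.

(** The plane at [beta] is not touched, which forces [q = 1/n]. The square root [s] in the formula
    for [tau] equals [tau + a], the right end of the ellipsoid, and the case condition says exactly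
    [s < beta]. *)
Lemma tangent_slab_shape (R : realType) (n : nat) (alpha beta : R)
    (tau : R) (b : R) : (0 < n)%N -> alpha < beta -> beta <= 1 ->
  alpha ^+ 2 < 1 -> alpha ^+ 2 <= beta ^+ 2 ->
  4 * n%:R * (1 - alpha ^+ 2) < (n%:R + 1) ^+ 2 * (beta ^+ 2 - alpha ^+ 2) ->
  tau = (alpha + Num.sqrt (alpha ^+ 2
           + 4 * n%:R * (1 - alpha ^+ 2) / (n%:R + 1) ^+ 2)) / 2 ->
  b = Num.sqrt ((tau - alpha) * (tau - alpha + n%:R * tau)) ->
  b ^+ 2 = (tau - alpha) * (tau - alpha + n%:R * tau) /\
  optimal_shape n alpha beta tau (tau - alpha) b n%:R^-1.
Proof.
move=> n_gt0 ab b1 al1 alb cond.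
have N1 : 1 <= n%:R :> R by rewrite ler1n.
have b0 : 0 < beta by move: alb; rewrite ler_sqr_addr_ge0//; lra.
have bb : beta ^+ 2 <= 1 by rewrite expr_le1// ltW.
(* For [n = 1] the case condition would read [1 < beta ^+ 2]. *)
have n1 : (1 < n)%N.
  rewrite ltnNge; apply/negP => n1.
  have nE : n%:R = 1 :> R by have /eqP -> : n == 1%N by rewrite eqn_leq n1.
  by move: cond; rewrite nE; lra.
set N := n%:R in N1 cond *.
set w := 4 * N * (1 - alpha ^+ 2) / (N + 1) ^+ 2.
have w0 : 0 < w.
  by rewrite /w; apply: divr_gt0; [apply: mulr_gt0; lra | apply: exprn_gt0; lra].
have N10 : N + 1 != 0 by rewrite gt_eqF//; lra.
have wN : w * (N + 1) ^+ 2 = 4 * N * (1 - alpha ^+ 2) by rewrite /w divfK// expf_neq0.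
set s := Num.sqrt _ => tauE.
have s2 : s ^+ 2 = alpha ^+ 2 + w by rewrite sqr_sqrtr//; have := sqr_ge0 alpha; lra.
have s0 : 0 <= s by exact: sqrtr_ge0.
have sb : s < beta.
  rewrite -(ltr_pXn2r (n := 2))// ?nnegrE ?ltW// s2 -ltrBrDl.
  rewrite /w ltr_pdivrMr; last by apply: exprn_gt0; lra.
  by rewrite [ltRHS]mulrC.
have sa : `|alpha| < s.
  rewrite -(ltr_pXn2r (n := 2))// ?nnegrE// real_normK ?num_real// s2; lra.
move: sa; rewrite ltr_norml => /andP[sa1 sa2].
have t0 : 0 < tau by lra.
have ta : 0 < tau - alpha by lra.
move=> bE; have b2 : b ^+ 2 = (tau - alpha) * (tau - alpha + N * tau).
  by rewrite bE sqr_sqrtr// mulr_ge0 ?ltW// addr_gt0// mulr_gt0//; lra.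
have bge0 : 0 <= b by rewrite bE sqrtr_ge0.
(* The quadratic equation solved by [tau]; with [q = 1/N] it is equivalent to the sphere
   condition. *)
have quad : (N + 1) ^+ 2 * (tau ^+ 2 - alpha * tau) = N * (1 - alpha ^+ 2).
  have -> : tau ^+ 2 - alpha * tau = (s ^+ 2 - alpha ^+ 2) / 4 by rewrite tauE; field.
  rewrite s2; lra.
have N0 : N != 0 by rewrite gt_eqF//; lra.
split => //; split => //.
- rewrite -(ler_pXn2r (n := 2))// ?nnegrE ?(ltW ta)// b2.
  rewrite [leLHS]expr2 ler_pM2l// lerDl mulr_ge0//; lra.
- by rewrite invr_ge0; lra.
- by rewrite mulfV.
- by rewrite b2; field; exact: N0.
- rewrite b2.
  have -> : (tau + (tau - alpha) / N) ^+ 2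
      + (tau - alpha) * (tau - alpha + N * tau) * (1 - N^-1 ^+ 2) =
    ((N + 1) ^+ 2 * (tau ^+ 2 - alpha * tau) - N * (1 - alpha ^+ 2)) / N + 1.
    by field.
  by rewrite quad subrr mul0r add0r.
- by rewrite subKr.
- lra.
- by right; rewrite mulfV.
Qed.

(** Both planes are touched. [A] and [C] are the radii of the sections of the ball by the planes at
    [alpha] and [beta], and rationalising turns the fraction in [B2] into their mean [m]. *)
Lemma band_slab_shape (R : realType) (n : nat) (alpha beta b : R) : (0 < n)%N ->
  alpha < beta -> beta <= 1 -> alpha ^+ 2 < beta ^+ 2 ->
  (n%:R + 1) ^+ 2 * (beta ^+ 2 - alpha ^+ 2) <= 4 * n%:R * (1 - alpha ^+ 2) ->
  let a := (beta - alpha) / 2 in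
  let B2 := a ^+ 2 + ((beta ^+ 2 - alpha ^+ 2)
     / (2 * (Num.sqrt (1 - alpha ^+ 2) - Num.sqrt (1 - beta ^+ 2)))) ^+ 2 in
  b = Num.sqrt B2 ->
  b ^+ 2 = B2 /\
  exists q, optimal_shape n alpha beta ((beta + alpha) / 2) a b q.
Proof.
move=> n_gt0 ab b1 alb cond a B2 bE.
have N1 : 1 <= n%:R :> R by rewrite ler1n.
have apb : 0 < beta + alpha.
  by move: alb; rewrite -subr_gt0 subr_sqr pmulr_rgt0// subr_gt0.
have b0 : 0 < beta by lra.
have bb : beta ^+ 2 <= 1 by rewrite expr_le1// ltW.
set A := Num.sqrt (1 - alpha ^+ 2) in B2 bE *.
set C := Num.sqrt (1 - beta ^+ 2) in B2 bE *.
have A2 : A ^+ 2 = 1 - alpha ^+ 2 by rewrite sqr_sqrtr//; lra.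
have C2 : C ^+ 2 = 1 - beta ^+ 2 by rewrite sqr_sqrtr//; lra.
have A0 : 0 <= A by exact: sqrtr_ge0.
have C0 : 0 <= C by exact: sqrtr_ge0.
have CA : C < A by rewrite -(ltr_pXn2r (n := 2))// ?nnegrE// A2 C2; lra.
pose m := (A + C) / 2.
have m0 : 0 < m by rewrite /m; lra.
have mE : (beta ^+ 2 - alpha ^+ 2) / (2 * (A - C)) = m.
  have -> : beta ^+ 2 - alpha ^+ 2 = A ^+ 2 - C ^+ 2 by rewrite A2 C2; ring.
  by rewrite /m; field; rewrite gt_eqF//; lra.
have B2E : B2 = a ^+ 2 + m ^+ 2 by rewrite /B2 mE.
have b2 : b ^+ 2 = a ^+ 2 + m ^+ 2.
  by rewrite bE sqr_sqrtr// B2E addr_ge0 ?sqr_ge0.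
split; first by rewrite B2E.
pose tau := (beta + alpha) / 2.
have a0 : 0 < a by rewrite /a; lra.
have t0 : 0 < tau by rewrite /tau; lra.
have mm : m != 0 by rewrite gt_eqF.
(* Since [b ^+ 2 - a ^+ 2 = m ^+ 2], the tangency condition determines [q]. The radii then become
   [A = m * (1 + q)] and [C = m * (1 - q)], so [0 <= C] yields [q <= 1]. *)
exists (a * tau / m ^+ 2).
set q := a * tau / m ^+ 2.
have qm : q * m ^+ 2 = a * tau by rewrite /q divfK// expf_neq0.
have q0 : 0 < q by apply: divr_gt0; [exact: mulr_gt0 | exact: exprn_gt0].
have AmC : (A - C) * m = 2 * (a * tau).
  have -> : (A - C) * m = (A ^+ 2 - C ^+ 2) / 2 by rewrite /m; field.
  by rewrite A2 C2 /a /tau; field.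
have Aq : A = m * (1 + q).
  apply: (mulIf mm); have -> : m * (1 + q) * m = m ^+ 2 + q * m ^+ 2 by ring.
  rewrite qm.
  have -> : a * tau = (A - C) * m / 2 by rewrite AmC; field.
  by rewrite /m; field.
have Cq : C = m * (1 - q) by rewrite /m in Aq *; lra.
have q1 : q <= 1.
  by have := C0; rewrite Cq pmulr_rge0// subr_ge0.
split.
- exact: a0.
- rewrite -(ler_pXn2r (n := 2))// ?nnegrE ?(ltW a0)// ?bE ?sqrtr_ge0//.
  by rewrite -bE b2 lerDl sqr_ge0.
- exact: ltW.
(* In terms of [q] the case condition factors as [0 <= (1 - n q) * (n - q)]. As [q <= 1 <= n], this
   gives [n q <= 1]; the second factor vanishes only for [q = n = 1]. *)
- have : (n%:R + 1) ^+ 2 * (4 * (q * m ^+ 2)) <= 4 * n%:R * (m * (1 + q)) ^+ 2.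
    rewrite -Aq A2; apply: le_trans cond.
    by rewrite qm le_eqVlt; apply/orP; left; apply/eqP; rewrite /a /tau; field.
  rewrite -subr_ge0.
  have -> : 4 * n%:R * (m * (1 + q)) ^+ 2 - (n%:R + 1) ^+ 2 * (4 * (q * m ^+ 2)) =
    (4 * m ^+ 2) * ((1 - n%:R * q) * (n%:R - q)) by ring.
  rewrite pmulr_rge0; last by rewrite mulr_gt0// exprn_gt0.
  have [nq|nq] := ltP q n%:R; first by rewrite pmulr_lge0 ?subr_ge0// subr_gt0.
  by move=> _; nra.
- by rewrite b2 addrAC subrr add0r qm.
- rewrite b2.
  have -> : ((beta + alpha) / 2 + a * q) ^+ 2 + (a ^+ 2 + m ^+ 2) * (1 - q ^+ 2)
    = (tau + a) ^+ 2 + (m * (1 - q)) ^+ 2 + 2 * (q * m ^+ 2 - a * tau)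
      + 2 * q * (a * tau - q * m ^+ 2) by rewrite /tau; ring.
  by rewrite -Cq C2 qm /tau /a; field.
- by rewrite /a; field.
- by rewrite /a; lra.
- by left; rewrite /a; field.
Qed.

Theorem theorem7p1 (R : realType) (n : nat) (n_gt0 : (0 < n)%N)
    (alpha beta : R) (h_alpha : -1 <= alpha) (h_lt : alpha < beta)
    (h_beta : beta <= 1) (h_sq : alpha ^+ 2 <= beta ^+ 2) :
  exists tau a b : R,
    [/\ alpha < tau < beta, 0 < a, 0 < b &
        is_IE (ball_slab n_gt0 alpha beta)
              (ellipsoid (tau *: e1 R n_gt0) (diag_ab n_gt0 a b))] /\
    [/\ (* (i) *)
        (alpha = - beta -> [/\ tau = 0, a = beta & b = 1]),
        (* (ii) *)
        (4 * n%:R * (1 - alpha ^+ 2)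
           < (n%:R + 1) ^+ 2 * (beta ^+ 2 - alpha ^+ 2) ->
         [/\ tau = (alpha + Num.sqrt (alpha ^+ 2
                      + 4 * n%:R * (1 - alpha ^+ 2) / (n%:R + 1) ^+ 2)) / 2,
             a = tau - alpha &
             b ^+ 2 = a * (a + n%:R * tau)]) &
        (* (iii) *)
        ((n%:R + 1) ^+ 2 * (beta ^+ 2 - alpha ^+ 2)
           <= 4 * n%:R * (1 - alpha ^+ 2) ->
         alpha <> - beta ->
         [/\ tau = (beta + alpha) / 2,
             a = (beta - alpha) / 2 &
             b ^+ 2 = a ^+ 2 +
               ((beta ^+ 2 - alpha ^+ 2)
                / (2 * (Num.sqrt (1 - alpha ^+ 2)
                        - Num.sqrt (1 - beta ^+ 2)))) ^+ 2])].
Proof.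
have [aE|anE] := eqVneq alpha (- beta).
  have b0 : 0 < beta by lra.
  have shape := symmetric_slab_shape n b0 h_beta.
  exists 0, beta, 1; split; last first.
    (* For [alpha = - beta] the right side of the condition of (ii) is 0 and the left side is
       nonnegative, so (ii) is vacuous. *)
    split => [//|H|_ /(_ aE) []]; move: H.
    rewrite aE sqrrN subrr mulr0 => H.
    have : 0 <= 4 * n%:R * (1 - beta ^+ 2).
      by rewrite !mulr_ge0// subr_ge0 expr_le1// ltW.
    by lra.
  split => //; first by lra.
  by rewrite {1}aE; exact: optimal_ellipsoid_is_IE shape.
have apb : 0 < beta + alpha.
  rewrite lt_neqAle -ler_sqr_addr_ge0// h_sq andbT eq_sym.
  by apply: contra anE; rewrite addrC addr_eq0.
have sq_lt : alpha ^+ 2 < beta ^+ 2.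
  by rewrite -subr_gt0 subr_sqr mulr_gt0// subr_gt0.
have sq_b : beta ^+ 2 <= 1 by rewrite expr_le1//; lra.
have a1 : alpha ^+ 2 < 1 by exact: lt_le_trans sq_b.
have [tang|band] := ltP (4 * n%:R * (1 - alpha ^+ 2))
  ((n%:R + 1) ^+ 2 * (beta ^+ 2 - alpha ^+ 2)).
  have [b2 shape] := tangent_slab_shape n_gt0 h_lt h_beta a1 h_sq tang erefl erefl.
  set tau := (alpha + _) / 2 in b2 shape.
  set b := Num.sqrt _ in b2 shape.
  have [a0 ab _ _ _ _ _ be _] := shape.
  exists tau, (tau - alpha), b; split; last first.
    by split=> // aE; rewrite aE eqxx in anE.
  split => //; [lra | exact: lt_le_trans ab | exact: optimal_ellipsoid_is_IE shape].
have [b2 [q shape]] := band_slab_shape n_gt0 h_lt h_beta sq_lt band erefl.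
set b := Num.sqrt _ in b2 shape.
have [a0 ab _ _ _ _ _ be _] := shape.
exists ((beta + alpha) / 2), ((beta - alpha) / 2), b; split; last first.
  by split=> // aE; rewrite aE eqxx in anE.
split => //; [lra | exact: lt_le_trans ab | exact: optimal_ellipsoid_is_IE shape].
Qed.
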